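(* Let $(\bar{A},\bar{B})$ be a structural pair, where $\bar{A}\in\{0,\star\}^{n\times n}$ is symmetrically structured and $\bar{B}\in\{0,\star\}^{n\times m}$ is a structured matrix, and let $\mathcal{T}\subseteq[n]$ be a target set. Let $\mathcal{X}_{\mathcal{T}}=\{x_i: i\in\mathcal{T}\}$ be the set of state vertices corresponding to $\mathcal{T}$ in the system digraph $\mathcal{D}(\bar{A},\bar{B})$. Then $(\bar{A},\bar{B})$ is structurally target controllable with respect to $\mathcal{T}$ if and only if the following two conditions hold simultaneously in $\mathcal{D}(\bar{A},\bar{B})$: 1) all the state vertices in $\mathcal{X}_{\mathcal{T}}$ are input-reachable; 2) $|\mathcal{N}(\mathcal{S})|\ge|\mathcal{S}|$ for all $\mathcal{S}\subseteq\mathcal{X}_{\mathcal{T}}$.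
   Context: $[n]=\{1,\dots,n\}$. A structured matrix $\bar{M}\in\{0,\star\}^{n\times m}$ is a matrix each of whose entries is either a fixed zero or an independent free (real) parameter, denoted $\star$. A matrix $\bar{A}\in\{0,\star\}^{n\times n}$ is symmetrically structured if, for all $i,j$, $[\bar{A}]_{ij}=\star$ if and only if $[\bar{A}]_{ji}=\star$, and the free parameter at $(i,j)$ is constrained to take the same value as the one at $(j,i)$ (otherwise the parameters are independent). A numerical realization of a (symmetrically) structured matrix is obtained by assigning real numbers to its independent free parameters (so realizations $\tilde{A}$ of $\bar{A}$ are real symmetric matrices). A numerical realization $(\tilde{A},\tilde{B})$ of the pair $(\bar A,\bar B)$ consists of numerical realizations of $\bar{A}$ and $\bar{B}$, the parameters of $\bar A$ and $\bar B$ being independent of each other. For $\mathcal{T}=\{i_1,\dots,i_k\}\subseteq[n]$, the matrix $C_{\mathcal{T}}\in\mathbb{R}^{k\times n}$ is defined by $[C_{\mathcal{T}}]_{\ell j}=1$ if $j=i_\ell$ and $0$ otherwise. The pair $(\bar{A},\bar{B})$ is structurally target controllable with respect to $\mathcal{T}$ if there exists a numerical realization $(\tilde{A},\tilde{B})$ such that $C_{\mathcal{T}}[\tilde{B},\tilde{A}\tilde{B},\dots,\tilde{A}^{n-1}\tilde{B}]$ has full row rank. The system digraph $\mathcal{D}(\bar{A},\bar{B})$ has vertex set $\mathcal{X}\cup\mathcal{U}$, with state vertices $\mathcal{X}=\{x_1,\dots,x_n\}$ and input vertices $\mathcal{U}=\{u_1,\dots,u_m\}$, and directed edges $(x_j,x_i)$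 whenever $[\bar{A}]_{ij}=\star$ and $(u_j,x_i)$ whenever $[\bar{B}]_{ij}=\star$. For a set $\mathcal{S}$ of vertices, $\mathcal{N}(\mathcal{S})$ is the in-neighbour set: the set of all vertices $v\in\mathcal{X}\cup\mathcal{U}$ such that $(v,w)$ is an edge for some $w\in\mathcal{S}$. A state vertex is input-reachable if there is a directed path to it from some input vertex. *)

(* Defs.v *)
From HB Require Import structures.
From mathcomp Require Import all_boot all_order all_algebra.
From mathcomp Require Import reals.

Set Implicit Arguments.
Unset Strict Implicit.
Unset Printing Implicit Defensive.

Import Order.TTheory GRing.Theory Num.Theory.
Local Open Scope ring_scope.

(* A structured matrix is encoded as a boolean matrix: [true] stands for a free
   parameter and [false] for a fixed zero.  Indices are 0-based: [n] is 'I_n. *)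
Definition structured_matrix (n m : nat) := 'M[bool]_(n, m).

Definition symmetrically_structured n (Abar : structured_matrix n n) : Prop :=
  forall i j, Abar i j = Abar j i.

(* The free parameters may take any real value, including 0. *)
Definition realization (R : realType) n m
    (Mbar : structured_matrix n m) (M : 'M[R]_(n, m)) : Prop :=
  forall i j, Mbar i j = false -> M i j = 0.

(* The parameters at (i, j) and (j, i) are one and the same. *)
Definition sym_realization (R : realType) n
    (Abar : structured_matrix n n) (A : 'M[R]_n) : Prop :=
  realization Abar A /\ (forall i j, A i j = A j i).

(* The rows of C_T follow the enumeration of T in increasing order. *)
Definition target_mx (R : realType) n (T : {set 'I_n}) : 'M[R]_(#|T|, n) :=
  \matrix_(l < #|T|, j < n) (j == enum_val l)%:R.

Definition controllability_mx (R : realType) n m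
    (A : 'M[R]_n) (B : 'M[R]_(n, m)) : 'M[R]_(n, \sum_(k < n) m) :=
  \mxrow_(k < n) (A ^+ k *m B).

Definition structurally_target_controllable (R : realType) n m
    (Abar : structured_matrix n n) (Bbar : structured_matrix n m)
    (T : {set 'I_n}) : Prop :=
  exists (A : 'M[R]_n) (B : 'M[R]_(n, m)),
    [/\ sym_realization Abar A, realization Bbar B
      & row_free (target_mx R T *m controllability_mx A B)].

(* [inl i] is the state vertex x_i and [inr j] is the input vertex u_j. *)
Definition vertex (n m : nat) : finType := ('I_n + 'I_m)%type.

(* The edge (x_j, x_i) comes from the (i, j) entry, so indices are swapped. *)
Definition system_digraph n m
    (Abar : structured_matrix n n) (Bbar : structured_matrix n m) :
    rel (vertex n m) :=
  fun v w => match v, w with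
             | inl j, inl i => Abar i j
             | inr j, inl i => Bbar i j
             | _, inr _ => false
             end.

Definition state_vertices n m (T : {set 'I_n}) : {set vertex n m} :=
  [set inl i | i in T].

Definition in_neighbours n m (e : rel (vertex n m)) (S : {set vertex n m}) :
    {set vertex n m} :=
  [set v | [exists w in S, e v w]].

Definition input_reachable n m (e : rel (vertex n m)) (x : vertex n m) : Prop :=
  exists j : 'I_m, connect e (inr j) x.

(* Main.v *)
Require Import Defs.
From HB Require Import structures.
From mathcomp Require Import all_boot all_order all_algebra.
From mathcomp Require Import reals.
From mathcomp Require Import zify ring lra complex polyrcf.

Set Implicit Arguments.
Unset Strict Implicit.
Unset Printing Implicit Defensive.

Import Order.TTheory GRing.Theory Num.Theory.
Local Open Scope ring_scope.

(* Necessity: entries of A^k B follow walks from the inputs, and a dependency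
   among the rows S of [A B] kills every A^k B.

   Sufficiency: the pair (A, B) is read off the symmetric matrix
   M = [[A, B], [B^T, 0]], a weighting of the undirected graph on states and
   inputs.  Hall's theorem matches T injectively to neighbours; weighting the
   matching edges suitably makes the rows T of M independent, and this is the
   nonvanishing of a polynomial Q.  By induction on the vertices, some weighting
   with Q != 0 has, moreover, no eigenvector with nonzero eigenvalue vanishing
   on the inputs: when a vertex is added, each of the finitely many nonzero
   eigenvalues of the smaller graph excludes only the zero set of a nonzero
   polynomial in the new weights.  For such an M, let W be the space of row
   vectors w with w A^k B = 0 for all k.  As A is symmetric, W A != 0 would give
   an eigenvector in W with nonzero eigenvalue, and hence one of M vanishing on
   the inputs.  So W A = W B = 0, and an element of W supported on T is a
   dependency among the rows T of M, hence 0. *)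

(** * Hall's marriage theorem *)

(* Rado's proof: if F x has two points, submodularity of the size of a union
   shows that one of them can be removed without losing Hall's condition. *)
Lemma hall_marriage (X Y : finType) (F : X -> {set Y}) :
  (forall S : {set X}, #|S| <= #|\bigcup_(x in S) F x|)%N ->
  exists2 f : X -> Y, injective f & forall x, f x \in F x.
Proof.
have [k] := ubnP (\sum_x #|F x|)%N.
elim: k F => // k IHk F; rewrite ltnS => leFk hallF.
have [/existsP[x /card_gt1P[y1 [y2 [Fy1 Fy2 neqy]]]]|] :=
  boolP [exists x, 1 < #|F x|]%N; last first.
  rewrite negb_exists => /forallP small.
  have card1 x : exists y, F x == [set y].
    have /cards1P[y ->] : #|F x| == 1%N; last by exists y.
    rewrite eqn_leq leqNgt small /=.
    by have := hallF [set x]; rewrite cards1 big_set1.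
  pose f x := xchoose (card1 x).
  have Ff x : F x = [set f x] by apply/eqP/(xchooseP (card1 x)).
  exists f => [x1 x2 eqf|x]; last by rewrite Ff set11.
  apply/eqP/negPn/negP => neqx; have := hallF [set x1; x2].
  by rewrite bigcup_setU !big_set1 !Ff eqf setUid cards1 cards2 neqx.
pose G y z := if z == x then F x :\ y else F z.
have subG y z : G y z \subset F z.
  by rewrite /G; case: eqP => [->|_] //; apply: subsetDl.
(* Either Hall's condition survives the removal of [y] and induction applies, or a set violating it
   contains [x], the only point where [G y] and [F] differ. *)
have trim y : y \in F x ->
    (exists2 f : X -> Y, injective f & forall x, f x \in F x) \/
    exists S : {set X}, [/\ (#|\bigcup_(z in S) G y z| < #|S|)%N & x \in S].
  move=> Fxy.
  have [/forallP hallG|] :=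
    boolP [forall S : {set X}, #|S| <= #|\bigcup_(z in S) G y z|]%N.
    left; have [|//|f injf Gf] := IHk (G y).
      apply: leq_trans leFk; rewrite (bigD1 x) //= [X in (_ < X)%N](bigD1 x) //=.
      rewrite -addSn leq_add //; first by rewrite /G eqxx [X in (_ < X)%N](cardsD1 y) Fxy.
      by apply: leq_sum => z _; apply/subset_leq_card/subG.
    by exists f => // z; apply: (subsetP (subG y z)).
  rewrite negb_forall => /existsP[S]; rewrite -ltnNge => ltS; right; exists S; split=> //.
  apply/negPn/negP => xS; move: ltS; rewrite ltnNge => /negP; apply.
  rewrite (eq_bigr F); first exact: hallF.
  by move=> z zS; rewrite /G; case: eqP => // zx; rewrite -zx zS in xS.
have [//|[S1 [lt1 xS1]]] := trim y1 Fy1.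
have [//|[S2 [lt2 xS2]]] := trim y2 Fy2.
set U1 := \bigcup_(z in S1) _ in lt1; set U2 := \bigcup_(z in S2) _ in lt2.
(* As [y1 != y2], [G y1 x] and [G y2 x] together cover [F x], so the union bound loses nothing; the
   intersection bound loses only the point [x]. That loss of one is less than the two gained from
   [lt1] and [lt2]. *)
have leU : (#|S1 :|: S2| <= #|U1 :|: U2|)%N.
  apply: leq_trans (hallF _) (subset_leq_card _).
  apply/subsetP => y /bigcupP[z zS Fzy]; have [zx|zx] := eqVneq z x.
    have [y_y1|yy1] := eqVneq y y1.
      apply/setUP; right; apply/bigcupP; exists x => //.
      by rewrite /G eqxx !inE y_y1 neqy.
    apply/setUP; left; apply/bigcupP; exists x => //.
    by rewrite /G eqxx !inE yy1 -zx.
  by apply/setUP; case/setUP: zS => zS; [left|right]; apply/bigcupP;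
    exists z; rewrite // /G (negPf zx).
have leI : (#|S1 :&: S2 :\ x| <= #|U1 :&: U2|)%N.
  apply: leq_trans (hallF _) (subset_leq_card _).
  apply/subsetP => y /bigcupP[z]; rewrite !inE => /and3P[zx zS1 zS2] Fzy.
  by apply/andP; split; apply/bigcupP; exists z; rewrite // /G (negPf zx).
have := cardsUI U1 U2; have := cardsUI S1 S2.
have := cardsD1 x (S1 :&: S2); rewrite inE xS1 xS2 /=; lia.
Qed.

(** * A symmetric matrix with independent rows from an injection *)

(* With edge weights c, column f t of w A = 0 reads
   c t w_t = - c (f t) w_(f (f t)).  Around an odd cycle of f the signs are
   incompatible; around an even cycle the weights are, since a single one of
   them is 2 and the others are 1. *)
Lemma injection_symmetric_mx (R : realFieldType) N (f : 'I_N -> 'I_N)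
    (T : {set 'I_N}) : injective f ->
  exists A : 'M[R]_N, [/\ A^T = A,
    forall i j, A i j != 0 -> (i \in T /\ f i = j) \/ (j \in T /\ f j = i) &
    forall w : 'rV_N, (forall i, i \notin T -> w 0 i = 0) -> w *m A = 0 -> w = 0].
Proof.
move=> injf.
(* [froot] selects one vertex on each cycle of [f]. *)
pose c t : R := if froot f t == t then 2 else 1.
have c0 t : 0 < c t by rewrite /c; case: ifP.
pose d i j : R := if (i \in T) && (f i == j) then c i else 0.
pose A : 'M[R]_N := \matrix_(i, j) (if i == j then d i i else d i j + d j i).
exists A; split.
- by apply/matrixP => i j; rewrite !mxE eq_sym; case: eqP => [->//|_]; rewrite addrC.
- move=> i j; rewrite mxE /d; case: (i =P j) => [<-|_].
    by case: ifP => [/andP[iT /eqP fi]|_]; [left|rewrite eqxx].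
  case: ifP => [/andP[iT /eqP fi]|_]; first by left.
  by case: ifP => [/andP[iT /eqP fi]|_]; [right|rewrite addr0 eqxx].
move=> w wT wA0.
(* As [f] is injective, column [f t] of [A] can be nonzero only in rows [t] and [f (f t)]. *)
have next t : w 0 t != 0 ->
    w 0 (f (f t)) != 0 /\ c t * w 0 t = - (c (f t) * w 0 (f (f t))).
  move=> wt; have tT : t \in T by apply: contraNT wt => /wT ->.
  have : (w *m A) 0 (f t) = 0 by rewrite wA0 mxE.
  have [ft|ft] := eqVneq (f t) t.
    rewrite mxE (bigD1 t) //= big1 ?addr0 => [|i it].
      rewrite mxE ft eqxx /d tT ft eqxx /= => /eqP.
      by rewrite mulf_eq0 (negPf wt) gt_eqF.
    rewrite mxE ft (negPf it) /d ft -{1}ft (inj_eq injf) (negPf it) andbF.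
    by rewrite eq_sym (negPf it) andbF addr0 mulr0.
  rewrite mxE (bigD1 t) //= mxE [t == _]eq_sym (negPf ft) {1}/d tT eqxx /=.
  have [fft|fft] := eqVneq (f (f t)) (f t).
    by move: ft; rewrite (injf _ _ fft) eqxx.
  have [ffft|ffft] := eqVneq (f (f t)) t.
    rewrite big1 ?addr0 => [|i it].
      rewrite /d ffft eqxx andbT; case: ifP => ftT; last first.
        by move/eqP; rewrite addr0 mulf_eq0 (negPf wt) gt_eqF.
      by move/eqP => h; split=> //; move/eqP: h; lra.
    rewrite mxE; case: eqP => [->|_].
      by rewrite /d (negPf fft) andbF mulr0.
    by rewrite /d (inj_eq injf) (negPf it) ffft eq_sym (negPf it) !andbF addr0 mulr0.
  rewrite {1}/d (negPf ffft) andbF addr0 (bigD1 (f (f t))) //=.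
  rewrite big1 ?addr0 => [|i /andP[it ifft]].
    rewrite mxE (negPf fft) /d (inj_eq injf) (negPf ffft) andbF eqxx andbT add0r.
    case: ifP => ftT; last first.
      by move/eqP; rewrite mulr0 addr0 mulf_eq0 (negPf wt) gt_eqF.
    move/eqP; have [->|wff] := eqVneq (w 0 (f (f t))) 0.
      by rewrite mul0r addr0 mulf_eq0 (negPf wt) gt_eqF.
    by move=> h; split=> //; move/eqP: h; lra.
  rewrite mxE; case: eqP => [->|_].
    by rewrite /d (negPf fft) andbF mulr0.
  by rewrite /d (inj_eq injf) (negPf it) [f (f t) == i]eq_sym (negPf ifft)
    !andbF addr0 mulr0.
apply/rowP => t0; rewrite mxE; apply/eqP/negPn/negP => wt0.
have even_iter k t : w 0 t != 0 -> w 0 (iter k.*2 f t) != 0.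
  by elim: k => //= k IHk /IHk/next[].
(* On an odd cycle the even iterates reach every vertex, so [w] vanishes nowhere on it. The product
   [y k] changes sign at each step, yet returns to itself after an odd number of steps. *)
have [odd_r|even_r] := boolP (odd (order f t0)).
  pose x k := w 0 (iter k f t0); pose y k := c (iter k f t0) * x k * x k.+1.
  have per k : x (k + order f t0)%N = x k by rewrite /x iterD iter_order.
  have x0 k : x k != 0.
    have even k' : ~~ odd k' -> x k' != 0.
      by move=> /even_halfK <-; apply: even_iter.
    have [odd_k|] := boolP (odd k); last exact: even.
    by rewrite -per even // oddD odd_k odd_r.
  have yS k : y k.+1 = - y k.
    have [_ /= e] := next _ (x0 k); rewrite /y e /x /= mulNr opprK; ring.
  have yE k : y k = (-1) ^+ k * y 0.
    by elim: k => [|k IHk]; rewrite ?mul1r // yS IHk exprS !mulN1r mulNr.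
  have := yE (order f t0); rewrite -signr_odd odd_r mulN1r.
  have -> : y (order f t0) = y 0.
    by rewrite /y -[order f t0]add0n -addSn !per iterD iter_order.
  move=> e; suff : y 0 != 0 by case/eqP; lra.
  by rewrite /y !mulf_neq0 // gt_eqF.
set b := findex f t0 (froot f t0).
have conn := connect_root (frel f) t0.
have bE : iter b f t0 = froot f t0 by apply: iter_findex.
(* [s] is at even distance from [t0], so [w] is nonzero there, and the vertex of weight 2 is [s] or
   [f s]. Along the even iterates of [s], the modulus of [w] changes by a factor 2 or 1/2 at the
   first step and then stays constant, so it cannot return to its initial value. *)
pose s := iter b./2.*2 f t0.
have ws : w 0 s != 0 by apply: even_iter.
have ord_s : order f s = order f t0.
  apply/esym/eq_card => z; apply: same_connect; first exact: fconnect_sym.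
  exact: fconnect_iter.
have sE : iter (odd b) f s = froot f t0 by rewrite -iterD odd_double_half.
have r2 : (1 < order f t0)%N.
  by have := order_gt0 f t0; case: (order f t0) even_r => // -[].
have cE i : (i < order f t0)%N -> c (iter i f s) = if i == odd b then 2 else 1.
  move=> ir; rewrite /c.
  have -> : froot f (iter i f s) = froot f t0.
    apply/eqP; rewrite root_connect; last exact: fconnect_sym.
    by rewrite fconnect_sym // -iterD fconnect_iter.
  rewrite -sE; congr (if _ then _ else _); apply/eqP/eqP => [|-> //].
  move=> /(congr1 (findex f s)); rewrite !findex_iter ?ord_s //.
  by apply: leq_trans r2; case: odd.
pose x k := `|w 0 (iter k.*2 f s)|.
have xS k : c (iter k.*2.+1 f s) * x k.+1 = c (iter k.*2 f s) * x k.
  have [_ /(congr1 Num.norm)] := next _ (even_iter k s ws).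
  by rewrite normrN !normrM !(gtr0_norm (c0 _)) /x => ->.
have xE k : (0 < k)%N -> (k.*2 <= order f t0)%N -> x k = x 1%N.
  elim: k => // -[//|k] IHk _ kr; rewrite -[RHS]IHk //; last by lia.
  have := xS k.+1; rewrite !cE //; try by lia.
  by rewrite !ifF ?mul1r //; case: odd.
have := xS 0%N; rewrite !cE //=; try by lia.
rewrite -(xE (order f t0)./2); last by rewrite even_halfK.
  rewrite /x even_halfK // -ord_s iter_order //.
  have : 0 < `|w 0 s| by rewrite normr_gt0.
  by case: odd => /=; lra.
by lia.
Qed.

(** * Eigenvectors of real symmetric matrices *)

Lemma mul_row_tr_eq0 (R : realDomainType) n (w : 'rV[R]_n) :
  ((w *m w^T) 0 0 == 0) = (w == 0).
Proof.
apply/eqP/eqP => [/eqP|->]; last by rewrite mul0mx mxE.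
rewrite mxE psumr_eq0 => [/allP w0|i _]; last by rewrite mxE -expr2 sqr_ge0.
apply/rowP => i; have /implyP/(_ isT) := w0 i (mem_index_enum i).
by rewrite !mxE -expr2 sqrf_eq0 => /eqP.
Qed.

(** Passing to the row space of [W *m A] excludes the eigenvalue 0, since [A] and its square have
    the same kernel. The matrix [N] of the restriction has a complex eigenvalue, which is real
    because [A] is symmetric. *)
Lemma symmetric_stable_eigenvector (R : rcfType) n (A W : 'M[R]_n) :
  A^T = A -> stablemx W A -> W *m A != 0 ->
  exists a, exists w : 'rV_n, [/\ a != 0, w != 0, (w <= W)%MS & w *m A = a *: w].
Proof.
move=> symA stabW WA0.
have kerA2 (w : 'rV[R]_n) : w *m A *m A = 0 -> w *m A = 0.
  move=> wAA; apply/eqP; rewrite -mul_row_tr_eq0 trmx_mul symA mulmxA wAA.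
  by rewrite mul0mx mxE.
pose V := row_base (W *m A).
have subV : (V <= W)%MS by rewrite eq_row_base.
have [N VA] : exists N, V *m A = N *m V.
  apply/submxP; rewrite (eqmxMr A (eq_row_base _)) eq_row_base.
  exact: submxMr.
have freeV : row_free V by apply: row_base_free.
have V0 : (0 < \rank (W *m A))%N by rewrite lt0n mxrank_eq0.
have [z /eigenvalueP[v vN v0]] := eigenvalue_closed (map_mx (real_complex R) N) V0.
pose Vc := map_mx (real_complex R) V; pose Ac := map_mx (real_complex R) A.
have [u u0 uA] : exists2 u : 'rV_n, u != 0 & u *m Ac = z *: u.
  exists (v *m Vc); last by rewrite -mulmxA -map_mxM VA map_mxM mulmxA vN -scalemxAl.
  apply: contraNneq v0 => u0; apply/eqP/(row_free_inj (A := Vc)); last by rewrite mul0mx.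
  by rewrite /Vc row_free_map.
pose uh := (map_mx conjc u)^T.
(* [u *m Ac *m uh] equals [z] times [u *m uh]; both products are their own conjugates and the latter
   is nonzero. *)
have real_z : conjc z = z.
  have S0 : (u *m uh) 0 0 != 0.
    apply: contra_neq u0 => /eqP; rewrite mxE psumr_eq0 => [/allP h|i _].
      apply/rowP => i; rewrite [RHS]mxE; have /implyP/(_ isT) := h i (mem_index_enum i).
      by rewrite !mxE mulf_eq0 conjc_eq0 orbb => /eqP.
    by rewrite !mxE mul_conjC_ge0.
  have conj_tr (M : 'M[R[i]]_1) : M^T = M by apply/matrixP => i j; rewrite mxE !ord1.
  have Ach : map_mx conjc Ac = Ac.
    by apply/matrixP => i j; rewrite !mxE conjc_real.
  have symAc : Ac^T = Ac by rewrite /Ac map_trmx symA.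
  have uhE : map_mx conjc uh = u^T.
    by apply/matrixP => i j; rewrite !mxE conjcK.
  have S_real : conjc ((u *m uh) 0 0) = (u *m uh) 0 0.
    rewrite -[in RHS](conj_tr (u *m uh)) trmx_mul trmxK.
    by rewrite -uhE -map_mxM [in RHS]mxE.
  have : (u *m Ac *m uh) 0 0 = conjc ((u *m Ac *m uh) 0 0).
    rewrite -[in LHS](conj_tr (u *m Ac *m uh)) !trmx_mul trmxK symAc mulmxA.
    by rewrite -uhE -[in LHS]Ach -!map_mxM [in LHS]mxE.
  rewrite uA -scalemxAl mxE rmorphM /= S_real => /mulIf e.
  by rewrite -e.
have [a za] : exists a, z = real_complex R a.
  case: z real_z {vN uA} => a b [] /eqP; rewrite eq_sym -addr_eq0 -mulr2n mulrn_eq0 /=.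
  move=> /eqP ->.
  by exists a.
have := eigenvalue_map (real_complex R) N a.
have -> : eigenvalue (map_mx (real_complex R) N) (real_complex R a).
  by apply/eigenvalueP; exists v; rewrite -?za.
move=> /esym/eigenvalueP[x xN x0].
have xVA : x *m V *m A = a *: (x *m V) by rewrite -mulmxA VA mulmxA xN -scalemxAl.
have xV0 : x *m V != 0.
  by apply: contraNneq x0 => xV; apply/eqP/(row_free_inj freeV); rewrite mul0mx.
exists a, (x *m V); split=> //; last exact: submx_trans (submxMl _ _) subV.
apply: contraNneq xV0 => a0; rewrite a0 scale0r in xVA.
have /submxP[y yE] : (x *m V <= W *m A)%MS.
  by apply: submx_trans (submxMl _ _) _; rewrite eq_row_base.
move: xVA; rewrite yE mulmxA => /kerA2 e; by rewrite e.
Qed.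

(** * Genericity along lines *)

(* A stand-in for multivariate polynomials: genericity arguments only restrict
   them to lines. *)
Definition line_polynomial (R : nzRingType) (V : lmodType R) (Q : V -> R) :=
  forall a b, exists p : {poly R}, forall t, Q (a + t *: b) = p.[t].

Lemma line_polynomialM (R : comNzRingType) (V : lmodType R) (P Q : V -> R) :
  line_polynomial P -> line_polynomial Q -> line_polynomial (fun x => P x * Q x).
Proof.
move=> polyP polyQ a b; have [p pE] := polyP a b; have [q qE] := polyQ a b.
by exists (p * q) => t; rewrite hornerM pE qE.
Qed.

Lemma line_polynomial_det (R : comNzRingType) (V : lmodType R) k
    (M : V -> 'M[R]_k) :
  (forall a b, exists X Y, forall t, M (a + t *: b) = X + t *: Y) ->
  line_polynomial (fun x => \det (M x)).
Proof.
move=> affM a b; have [X [Y XY]] := affM a b.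
exists (\det (map_mx polyC X + 'X *: map_mx polyC Y)) => t.
rewrite XY -horner_evalE -det_map_mx; congr (\det _).
by apply/matrixP => i j; rewrite !mxE /= /horner_eval !hornerE.
Qed.

Lemma exists_nonroot (R : numDomainType) (p : {poly R}) :
  p != 0 -> exists t, p.[t] != 0.
Proof.
move=> p0; pose s := [seq i%:R : R | i <- iota 0 (size p)].
have [/allP roots|/allPn[t _ pt]] := boolP (all (root p) s); last by exists t.
have : (size s < size p)%N.
  apply: max_poly_roots => //; first exact/allP.
  by rewrite map_inj_uniq ?iota_uniq // => i j /eqP; rewrite eqr_nat => /eqP.
by rewrite size_map size_iota ltnn.
Qed.

(** On the line through [a] and [b], which stays in [K], both functions become polynomials, nonzero
    at parameter 0 and 1 respectively. *)
Lemma line_polynomial_common_nonroot (R : numDomainType) (V : lmodType R)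
    (K : V -> Prop) (P Q : V -> R) a b :
  (forall x y t, K x -> K y -> K (x + t *: y)) ->
  line_polynomial P -> line_polynomial Q -> K a -> K b -> P a != 0 -> Q b != 0 ->
  exists2 x, K x & P x * Q x != 0.
Proof.
move=> linK polyP polyQ Ka Kb Pa Qb.
have Kba : K (b - a) by rewrite -scaleN1r; apply: linK.
have [p pE] := polyP a (b - a); have [q qE] := polyQ a (b - a).
have [] := @exists_nonroot _ (p * q).
  rewrite mulf_neq0 //.
    by apply: contraNneq Pa => p0; rewrite -[a]addr0 -[X in _ + X](scale0r (b - a)) pE p0 horner0.
  by apply: contraNneq Qb => q0; rewrite -[b](subrKC a) -[b - a]scale1r qE q0 horner0.
move=> t pq; exists (a + t *: (b - a)); first exact: linK.
by rewrite pE qE -hornerM.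
Qed.

(** Induction on [s] multiplies the polynomial attached to each [l] into [P]. *)
Lemma line_polynomials_common_nonroot (R : numDomainType) (V : lmodType R)
    (K : V -> Prop) (s : seq R) (G : R -> V -> Prop) (P : V -> R) a :
  (forall x y t, K x -> K y -> K (x + t *: y)) ->
  line_polynomial P -> K a -> P a != 0 ->
  (forall l, l \in s -> exists Q, [/\ line_polynomial Q,
     exists2 x, K x & Q x != 0 & forall x, K x -> Q x != 0 -> G l x]) ->
  exists x, [/\ K x, P x != 0 & forall l, l \in s -> G l x].
Proof.
move=> linK; elim: s P a => [|l s IHs] P a polyP Ka Pa sQ; first by exists a.
have [Q [polyQ [b Kb Qb] QG]] := sQ l (mem_head _ _).
have [c Kc PQc] := line_polynomial_common_nonroot linK polyP polyQ Ka Kb Pa Qb.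
have [|x [Kx]] := IHs _ c (line_polynomialM polyP polyQ) Kc PQc.
  by move=> l' l's; apply: sQ; rewrite inE l's orbT.
rewrite mulf_eq0 negb_or => /andP[Px Qx] Gs; exists x; split=> // l'.
by rewrite inE => /predU1P[->|]; [apply: QG | apply: Gs].
Qed.

(** * Generic weightings of a graph *)

(** Vertices outside [V] remain as zero rows and columns, so induction on the graph does not change
    the matrix type. Loops are allowed. *)
Definition weighted_adjacency (R : nzRingType) N (e : rel 'I_N) (V : {set 'I_N})
    (A : 'M[R]_N) :=
  A^T = A /\ forall i j, ~~ [&& i \in V, j \in V & e i j] -> A i j = 0.

(* Each nonzero eigenvalue is simple, with an eigenvector not vanishing on I. *)
Definition detects_modes (R : fieldType) N (I : {set 'I_N}) (A : 'M[R]_N) :=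
  forall l, l != 0 -> eigenvalue A l ->
  exists2 k, k \in I & forall x : 'rV_N, x *m A = l *: x -> x 0 k = 0 -> x = 0.

Lemma weighted_adjacency_lin (R : comNzRingType) N (e : rel 'I_N) V (A B : 'M[R]_N) t :
  weighted_adjacency e V A -> weighted_adjacency e V B ->
  weighted_adjacency e V (A + t *: B).
Proof.
move=> [symA suppA] [symB suppB]; split=> [|i j ij].
  by rewrite linearD linearZ /= symA symB.
by rewrite !mxE suppA // suppB // mulr0 addr0.
Qed.

(** Let [D] range over the weights at [i]. For [l != 0], an eigenvector of [A + D] vanishing at [i]
    is one of [A] killed by [D]; so [i] detects every [l] that is not an eigenvalue of [A]. The
    neighbours of [i] detect in the smaller graph because [i], a vertex of [I], sees them. *)
Lemma add_vertex (R : rcfType) N (e : rel 'I_N) (V I : {set 'I_N}) (A D0 : 'M[R]_N)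
    (i : 'I_N) (Q : 'M[R]_N -> R) :
  symmetric e -> i \in V -> i \in I ->
  weighted_adjacency e (V :\ i) A ->
  detects_modes (I :\ i :|: [set j in V :\ i | e i j]) A ->
  line_polynomial Q ->
  weighted_adjacency e V D0 -> (forall j k, j != i -> k != i -> D0 j k = 0) ->
  Q (A + D0) != 0 ->
  exists B, [/\ weighted_adjacency e V B, Q B != 0 & detects_modes I B].
Proof.
move=> syme iV iI [symA suppA] detA polyQ adjD0 starD0 QD0.
pose K D := weighted_adjacency e V D /\ forall j k, j != i -> k != i -> D j k = 0 :> R.
have linK D D' t : K D -> K D' -> K (D + t *: D').
  move=> [adjD starD] [adjD' starD']; split; first exact: weighted_adjacency_lin.
  by move=> j k ji ki; rewrite !mxE starD // starD' // mulr0 addr0.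
have K0 : K 0 by split; [split; [exact: trmx0 | move=> *; rewrite mxE] | move=> *; rewrite mxE].
have Ai k : A k i = 0 by rewrite suppA // !inE eqxx andbF.
have eig_i l (x : 'rV[R]_N) : l != 0 -> x *m A = l *: x -> x 0 i = 0.
  move=> l0 /matrixP/(_ 0 i); rewrite !mxE big1 => [|k _]; last by rewrite Ai mulr0.
  by move/esym/eqP; rewrite mulf_eq0 (negPf l0) => /eqP.
have drop_i D l (x : 'rV[R]_N) : K D -> l != 0 -> x *m (A + D) = l *: x -> x 0 i = 0 ->
    x *m A = l *: x /\ x *m D = 0.
  move=> [_ starD] l0 xAD xi.
  have xA : x *m A = l *: x.
    apply/rowP => k; have [->|ki] := eqVneq k i.
      by rewrite !mxE xi mulr0 big1 // => j _; rewrite Ai mulr0.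
    rewrite -xAD !mxE; apply: eq_bigr => j _; rewrite mxE.
    have [->|ji] := eqVneq j i; first by rewrite xi !mul0r.
    by rewrite starD // addr0.
  by split=> //; apply: (addrI (x *m A)); rewrite -mulmxDr xAD xA addr0.
have good_poly l : l != 0 -> eigenvalue A l -> exists q : 'M[R]_N -> R,
    [/\ line_polynomial q, exists2 D, K D & q D != 0 & forall D, K D -> q D != 0 ->
     exists2 k, k \in I &
       forall x : 'rV_N, x *m (A + D) = l *: x -> x 0 k = 0 -> x = 0].
  move=> l0 eigl; have [k kI' detk] := detA l l0 eigl.
  have /eigenvalueP[w wA w0] := eigl.
  have wk : w 0 k != 0 by apply: contra_neq w0; apply: detk.
  have line (x : 'rV_N) : x *m A = l *: x -> x = (x 0 k / w 0 k) *: w.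
    move=> xA; apply/eqP; rewrite -subr_eq0; apply/eqP/detk.
      by rewrite mulmxBl -scalemxAl wA xA scalerBr !scalerA mulrC.
    by rewrite !mxE divfK // subrr.
  have wi := eig_i l w l0 wA.
  have ww0 : (w *m w^T) 0 0 != 0 by rewrite mul_row_tr_eq0.
  have symAl : (A - l%:M)^T = A - l%:M by rewrite linearB /= symA tr_scalar_mx.
  (* If [w] is nonzero at a neighbour of [i], a generic [D] makes [w *m D] nonzero at [i], and [i]
     detects [l]. Otherwise [k] is already in [I]. *)
  have [/existsP[j /and4P[jV ji eij wj]]|] :=
      boolP [exists j, [&& j \in V, j != i, e i j & w 0 j != 0]].
    exists (fun D => (w *m D) 0 i); split.
    - move=> D D'; exists (((w *m D) 0 i)%:P + (w *m D') 0 i *: 'X) => t.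
      by rewrite mulmxDr -scalemxAr !hornerE !mxE mulrC.
    - pose E : 'M[R]_N := delta_mx i j + delta_mx j i; exists E; first split; first split.
      + by rewrite linearD /= !trmx_delta addrC.
      + move=> a b; rewrite !mxE => ab.
        case: andP => [[/eqP ai /eqP bj]|_]; first by rewrite ai bj iV jV eij in ab.
        case: andP => [[/eqP aj /eqP bi]|_]; last by rewrite addr0.
        by rewrite aj bi jV iV (syme j i) eij in ab.
      + by move=> a b ai bi; rewrite !mxE (negPf ai) (negPf bi) andbF addr0.
      + rewrite mxE (bigD1 j) //= big1 => [|b bj].
          by rewrite !mxE !eqxx (negPf ji) /= add0r addr0 mulr1.
        rewrite !mxE (negPf bj) andFb addr0.
        by case: eqP => [->|_]; rewrite ?wi ?mul0r ?mulr0.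
    move=> D KD wD; exists i => // x xAD xi.
    have [xA xD0] := drop_i D l x KD l0 xAD xi.
    have xE := line x xA; move: xD0; rewrite xE -scalemxAl => /matrixP/(_ 0 i).
    by rewrite !mxE in wD * => /eqP; rewrite mulf_eq0 (negPf wD) orbF => /eqP ->; rewrite scale0r.
  rewrite negb_exists => /forallP noj.
  have wnbr j : j \in V -> j != i -> e i j -> w 0 j = 0.
    by move=> jV ji eij; have := noj j; rewrite jV ji eij /= negbK => /eqP.
  have kI : k \in I.
    have := kI'; rewrite !inE => /orP[/andP[]//|/andP[/andP[ki kV] eik]].
    by rewrite wnbr ?eqxx in wk.
  (* Here w D = 0 for every D in K; det (A + D - l + w^T w) != 0 says that the
     eigenspace of A + D for l is still spanned by w. *)
  exists (fun D => \det (A + D - l%:M + w^T *m w)); split.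
  - apply: line_polynomial_det => D D'; exists (A + D - l%:M + w^T *m w), D' => t.
    by rewrite addrA -!addrA; do 2 congr (_ + _); rewrite addrC -!addrA.
  (* Multiplying by [w^T], which [A - l%:M] kills by symmetry, shows that a kernel vector is
     orthogonal to [w]. It then lies in the eigenspace of [A], so it is a multiple of [w], hence
     0. *)
  - exists 0 => //; rewrite addr0 -unitfE -unitmxE -row_free_unit -kermx_eq0.
    apply/eqP/row_matrixP => r; rewrite row0.
    set x := row r _; have xAw : x *m (A - l%:M + w^T *m w) = 0.
      by rewrite /x -row_mul mulmx_ker row0.
    have xw : x *m w^T = 0.
      have : x *m (A - l%:M + w^T *m w) *m w^T = 0 by rewrite xAw mul0mx.
      rewrite mulmxDr mulmxDl -mulmxA.
      have -> : (A - l%:M) *m w^T = 0.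
        by apply: trmx_inj; rewrite trmx_mul trmxK symAl trmx0 mulmxBr wA mul_mx_scalar subrr.
      rewrite mulmx0 add0r -!mulmxA [w *m _]mx11_scalar mul_mx_scalar -scalemxAr => /eqP.
      by rewrite scaler_eq0 (negPf ww0) => /eqP.
    have xA : x *m A = l *: x.
      move: xAw; rewrite mulmxDr mulmxA xw mul0mx addr0 mulmxBr mul_mx_scalar => /eqP.
      by rewrite subr_eq0 => /eqP.
    move/eqP: xw; rewrite (line x xA) -scalemxAl => /eqP/matrixP/(_ 0 0).
    rewrite [in RHS]mxE mxE => /eqP; rewrite mulf_eq0 (negPf ww0) orbF => /eqP ->.
    by rewrite scale0r.
  move=> D KD qD; exists k => // x xAD xk.
  have [[_ suppD] starD] := KD.
  have wD : w *m D = 0.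
    apply/rowP => j; rewrite !mxE big1 // => a _.
    have [->|ai] := eqVneq a i; first by rewrite wi mul0r.
    have [->|ji] := eqVneq j i; last by rewrite starD ?mulr0.
    have [/and3P[aV _ eai]|] := boolP [&& a \in V, i \in V & e a i].
      by rewrite wnbr ?mul0r // syme.
    by move/suppD ->; rewrite mulr0.
  (* [x] minus its orthogonal projection on [w] is killed by the nonsingular matrix of [qD]. So [x]
     is a multiple of [w], and [w] does not vanish at [k]. *)
  pose c := (x *m w^T) 0 0 / (w *m w^T) 0 0.
  have y0 : x - c *: w = 0.
    apply: (row_free_inj (A := A + D - l%:M + w^T *m w)).
      by rewrite row_free_unit unitmxE unitfE.
    have yw : (x - c *: w) *m w^T = 0.
      apply/matrixP => a b; rewrite !ord1 mulmxBl -scalemxAl [LHS]mxE [RHS]mxE.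
      by rewrite [X in _ + X]mxE [X in _ - X]mxE /c divfK ?subrr.
    rewrite mul0mx mulmxDr mulmxA yw mul0mx addr0 mulmxBr mul_mx_scalar mulmxBl xAD.
    by rewrite -scalemxAl mulmxDr wA wD addr0 scalerBr !scalerA [c * l]mulrC subrr.
  move/rowP/(_ k): (y0); rewrite !mxE xk sub0r => /eqP;
    rewrite oppr_eq0 mulf_eq0 (negPf wk) orbF.
  by move=> /eqP c0; move: y0; rewrite c0 scale0r subr0.
have in_rootsR l : (l \in rootsR (char_poly A)) = eigenvalue A l.
  rewrite -(roots_on_rootsR (monic_neq0 (char_poly_monic A))) eigenvalue_root_char.
  by rewrite in_itv.
have [D [KD QD detD]] : exists D, [/\ K D, Q (A + D) != 0 &
     forall l, l \in [seq l <- rootsR (char_poly A) | l != 0] ->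
     exists2 k, k \in I &
       forall x : 'rV_N, x *m (A + D) = l *: x -> x 0 k = 0 -> x = 0].
  apply: (@line_polynomials_common_nonroot _ _ K _ _ (fun D => Q (A + D)) D0) => //.
    by move=> a b; have [p pE] := polyQ (A + a) b; exists p => t; rewrite addrA.
  move=> l; rewrite mem_filter in_rootsR => /andP[l0 eigl].
  exact: good_poly.
exists (A + D); split=> //.
  rewrite -[D]scale1r; apply: weighted_adjacency_lin; last by case: KD.
  split=> // j k jk; apply: suppA; apply: contra jk.
  by rewrite !inE => /and3P[/andP[_ ->] /andP[_ ->] ->].
move=> l l0 _; have [eigl|eigl] := boolP (eigenvalue A l).
  by apply: detD; rewrite mem_filter l0 in_rootsR.
exists i => // x xAD xi; have [xA _] := drop_i D l x KD l0 xAD xi.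
by apply/eqP; apply: contraNT eigl => x0; apply/eigenvalueP; exists x.
Qed.

(* The hypothesis on C says that every vertex of V is connected to I within V. *)
Lemma generic_modes_detected (R : rcfType) N (e : rel 'I_N) (V I : {set 'I_N})
    (A : 'M[R]_N) (Q : 'M[R]_N -> R) :
  symmetric e ->
  (forall C : {set 'I_N}, C \subset V -> [disjoint C & I] ->
     (forall x y, x \in C -> y \in V -> e x y -> y \in C) -> C = set0) ->
  line_polynomial Q -> weighted_adjacency e V A -> Q A != 0 ->
  exists B, [/\ weighted_adjacency e V B, Q B != 0 & detects_modes I B].
Proof.
move=> syme; have [k] := ubnP #|V|.
elim: k V I A Q => // k IHk V I A Q ltVk reach polyQ [symA suppA] QA.
have [V0|[i /setIP[iV iI]]] := set_0Vmem (V :&: I).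
  have {}V0 : V = set0.
    by apply: (reach V) => //; rewrite -setI_eq0 V0.
  exists A; split=> // l l0 /eigenvalueP[w wA w0].
  case/eqP: w0; apply: (scalerI l0); rewrite -wA scaler0.
  suff -> : A = 0 by rewrite mulmx0.
  by apply/matrixP => i j; rewrite suppA ?mxE // V0 inE.
(* [A'] erases [i] from [A], and [Q] is translated by the erased part [A - A'], which then serves as
   [D0] in [add_vertex]. *)
pose A' : 'M[R]_N := \matrix_(a, b) if (a == i) || (b == i) then 0 else A a b.
pose V' := V :\ i; pose I' := I :\ i :|: [set j in V' | e i j].
have [|||||B [adjB QB detB]] := IHk V' I' A' (fun B => Q (B + (A - A'))).
- by rewrite -ltnS; apply: leq_trans ltVk; rewrite ltnS [X in (_ < X)%N](cardsD1 i) iV.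
(* A closed [C] avoiding [I'] contains no neighbour of [i], so it stays closed when [i] is put
   back. *)
- move=> C CV CI' closedC; apply: reach.
  + exact: subset_trans CV (subD1set _ _).
  + apply/pred0P => j /=; apply/negP => /andP[jC jI].
    have := subsetP CV j jC; rewrite !inE => /andP[ji _].
    by move/pred0P: CI' => /(_ j); rewrite /= jC !inE ji jI.
  + move=> x y xC yV exy; have [yi|yi] := eqVneq y i.
      move/pred0P: CI' => /(_ x); rewrite /= xC !inE.
      have := subsetP CV x xC; rewrite !inE => /andP[-> ->].
      by rewrite syme -yi exy orbT.
    by apply: closedC exy; rewrite // !inE yi.
- move=> a b; have [p pE] := polyQ (a + (A - A')) b; exists p => t.
  by rewrite -pE addrAC.
- split=> [|a b]; first by apply/matrixP => a b; rewrite !mxE orbC -{1}symA mxE.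
  rewrite !mxE !inE; case: eqP => //= _; case: eqP => //= _; exact: suppA.
- by rewrite subrKC.

apply: (add_vertex syme iV iI adjB detB polyQ _ _ QB).
  split=> [|a b ab].
    rewrite linearB /= symA; congr (_ - _).
    by apply/matrixP => a b; rewrite !mxE orbC -{1}symA mxE.
  by rewrite !mxE suppA // if_same subrr.
by move=> a b ai bi; rewrite !mxE (negPf ai) (negPf bi) subrr.
Qed.

(** * Target rows and the left kernel of the controllability matrix *)

Lemma mul_target_mxE (R : realType) n (T : {set 'I_n}) (w : 'rV[R]_#|T|) a :
  (w *m target_mx R T) 0 (enum_val a) = w 0 a.
Proof.
rewrite mxE (bigD1 a) //= mxE eqxx mulr1 big1 ?addr0 // => b ba.
by rewrite mxE (inj_eq enum_val_inj) eq_sym (negPf ba) mulr0.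
Qed.

Lemma mul_target_mx0 (R : realType) n (T : {set 'I_n}) (w : 'rV[R]_#|T|) i :
  i \notin T -> (w *m target_mx R T) 0 i = 0.
Proof.
move=> iT; rewrite mxE big1 // => a _; rewrite mxE.
by case: eqP => [ia|_]; [rewrite ia enum_valP in iT | rewrite mulr0].
Qed.

Lemma row_free_target_mxP (R : realType) n p (T : {set 'I_n}) (M : 'M[R]_(n, p)) :
  row_free (target_mx R T *m M) <->
  forall w : 'rV_n, (forall i, i \notin T -> w 0 i = 0) -> w *m M = 0 -> w = 0.
Proof.
split=> [freeM w wT wM|inj].
  pose z : 'rV[R]_#|T| := \row_a w 0 (enum_val a).
  have wE : w = z *m target_mx R T.
    apply/rowP => i; have [iT|iT] := boolP (i \in T).
      by rewrite -(enum_rankK_in iT iT) mul_target_mxE mxE.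
    by rewrite wT // mul_target_mx0.
  suff z0 : z = 0 by rewrite wE z0 mul0mx.
  by apply: (row_free_inj freeM); rewrite mulmxA -wE wM mul0mx.
rewrite -kermx_eq0; apply/eqP/row_matrixP => r; rewrite row0.
set z := row r _; suff z0 : z *m target_mx R T = 0.
  by apply/rowP => a; rewrite -mul_target_mxE z0 !mxE.
apply: inj => [i|]; first exact: mul_target_mx0.
by rewrite -mulmxA /z -row_mul mulmx_ker row0.
Qed.

(** By Cayley-Hamilton, with the coefficients of ['X^k] modulo the characteristic polynomial. It
    lifts the bound [k < n] on exponents, which makes the left kernel of the controllability matrix
    stable under [A]. *)
Lemma expr_mx_span (F : fieldType) n (A : 'M[F]_n) k :
  exists c : nat -> F, A ^+ k = \sum_(i < n) c i *: A ^+ i.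
Proof.
case: n A => [|n] A; first by exists (fun=> 0); apply/matrixP => -[].
pose r := 'X^k %% char_poly A; exists (fun i => r`_i).
have rE : \poly_(i < n.+1) r`_i = r.
  apply/polyP => i; rewrite coef_poly; case: ltnP => // ni; rewrite nth_default //.
  apply: leq_trans ni; rewrite -ltnS -(size_char_poly A) ltn_modp.
  by rewrite monic_neq0 ?char_poly_monic.
have -> : A ^+ k = horner_mx A r.
  have := congr1 (horner_mx A) (divp_eq 'X^k (char_poly A)).
  rewrite rmorphXn /= horner_mx_X => ->.
  by rewrite rmorphD rmorphM /= Cayley_Hamilton mulr0 add0r.
rewrite -[in LHS]rE poly_def rmorph_sum /=; apply: eq_bigr => i _.
by rewrite linearZ /= rmorphXn /= horner_mx_X.
Qed.

Lemma mul_controllability_mx_eq0 (R : realType) n m p (A : 'M[R]_n) (B : 'M[R]_(n, m))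
    (w : 'M[R]_(p, n)) :
  w *m controllability_mx A B = 0 <-> forall k, w *m (A ^+ k *m B) = 0.
Proof.
rewrite /controllability_mx mul_mxrow -[X in _ = X](mxrow0 _); split=> [/eq_mxrowP wAB k|wAB].
  have [c ->] := expr_mx_span A k.
  rewrite mulmx_suml mulmx_sumr big1 // => i _.
  by rewrite -scalemxAl -scalemxAr wAB scaler0.
by apply/eq_mxrowP => k; apply: wAB.
Qed.

Lemma controllability_mx_stable (R : realType) n m (A : 'M[R]_n) (B : 'M[R]_(n, m)) :
  stablemx (kermx (controllability_mx A B)) A.
Proof.
apply/sub_kermxP; apply/mul_controllability_mx_eq0 => k.
have /mul_controllability_mx_eq0/(_ k.+1) := mulmx_ker (controllability_mx A B).
by rewrite exprS -!mulmxA => ->.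
Qed.

(** * Necessity of the two conditions *)

Lemma expr_mx_connect (R : realType) n m (Abar : structured_matrix n n)
    (Bbar : structured_matrix n m) (A : 'M[R]_n) (B : 'M[R]_(n, m)) k i j :
  realization Abar A -> realization Bbar B -> (A ^+ k *m B) i j != 0 ->
  connect (system_digraph Abar Bbar) (inr j) (inl i).
Proof.
move=> realA realB; elim: k i => [|k IHk] i.
  have -> : A ^+ 0 *m B = B by apply: mul1mx.
  by move=> Bij; apply: connect1 => /=; apply: contraNT Bij => /negbTE/realB ->.
have -> : A ^+ k.+1 *m B = A *m (A ^+ k *m B) by rewrite mulmxA exprS.
have [/existsP[l /andP[Ail Bl]]|] :=
  boolP [exists l, (A i l != 0) && ((A ^+ k *m B) l j != 0)].
  move=> _; apply: connect_trans (IHk l Bl) (connect1 _) => /=.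
  by apply: contraNT Ail => /negbTE/realA ->.
rewrite negb_exists => /forallP h; rewrite mxE big1 ?eqxx // => l _.
by have := h l; rewrite negb_and !negbK => /orP[] /eqP ->; rewrite ?mul0r ?mulr0.
Qed.

Lemma target_controllable_reachable (R : realType) n m (Abar : structured_matrix n n)
    (Bbar : structured_matrix n m) (T : {set 'I_n}) i :
  structurally_target_controllable R Abar Bbar T -> i \in T ->
  input_reachable (system_digraph Abar Bbar) (inl i).
Proof.
move=> [A [B [[realA _] realB /row_free_target_mxP inj]]] iT.
have [/existsP//|] := boolP [exists j, connect (system_digraph Abar Bbar) (inr j) (inl i)].
rewrite negb_exists => /forallP unreach.
suff : delta_mx 0 i = 0 :> 'rV[R]_n.
  by move/rowP/(_ i); rewrite !mxE !eqxx => /eqP; rewrite oner_eq0.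
apply: inj => [k kT|].
  by rewrite mxE; case: (k =P i) => [ki|_]; [rewrite ki iT in kT | rewrite andbF].
apply/mul_controllability_mx_eq0 => k; rewrite -rowE; apply/rowP => j; rewrite !mxE.
apply/eqP; apply: contraNT (unreach j) => ABij.
by apply: (expr_mx_connect (k := k) realA realB); rewrite mxE.
Qed.

Lemma target_controllable_expansion (R : realType) n m (Abar : structured_matrix n n)
    (Bbar : structured_matrix n m) (T : {set 'I_n}) (S : {set vertex n m}) :
  structurally_target_controllable R Abar Bbar T -> S \subset state_vertices m T ->
  (#|S| <= #|in_neighbours (system_digraph Abar Bbar) S|)%N.
Proof.
move=> [A [B [[realA _] realB /row_free_target_mxP inj]]] ST.
pose S0 : {set 'I_n} := [set i | inl i \in S].
have SE : S = state_vertices m S0.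
  apply/setP => v; apply/idP/imsetP => [vS|[i iS0 ->]]; last by rewrite inE in iS0.
  by have /imsetP[i _ vE] := subsetP ST v vS; exists i; rewrite // inE -vE.
set NS := in_neighbours _ S; pose N0 : {set 'I_(n + m)} := unsplit @: NS.
have -> : #|NS| = #|N0| by rewrite card_imset //; apply: can_inj unsplitK.
have -> : #|S| = #|S0| by rewrite SE card_imset // => i j [].
(* [M] cuts [row_mx A B] down to rows [S0] and columns [N0]. On these rows the other columns vanish,
   so independence is preserved, and it bounds the number of rows by the number of columns. *)
pose M := target_mx R S0 *m row_mx A B *m (target_mx R N0)^T.
suff : row_free M by rewrite -row_leq_rank => /leq_trans; apply; apply: rank_leq_col.
rewrite -kermx_eq0; apply/eqP/row_matrixP => r; rewrite row0.
set z := row r _; pose w := z *m target_mx R S0.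
have zM : z *m M = 0 by rewrite /z -row_mul mulmx_ker row0.
have wS i : i \notin S0 -> w 0 i = 0 by apply: mul_target_mx0.
suff w0 : w = 0.
  by apply/rowP => a; rewrite -mul_target_mxE -/w w0 !mxE.
have zero c i : c \notin N0 -> i \in S0 -> row_mx A B i c = 0.
  move=> cN iS; rewrite mxE; case: splitP => j cj; [apply: realA | apply: realB];
    apply: contraNF cN => edge; apply/imsetP; [exists (inl j) | exists (inr j)];
    rewrite /= ?inE; try (by apply: val_inj); apply/existsP; exists (inl i);
    by rewrite /= edge; rewrite inE in iS; rewrite iS.
have wAB0 : w *m row_mx A B = 0.
  apply/rowP => c; rewrite [RHS]mxE; have [cN|cN] := boolP (c \in N0).
    move/rowP: zM => /(_ (enum_rank_in cN c)); rewrite [RHS]mxE => <-.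
    rewrite /M !mulmxA -/w [RHS]mxE (bigD1 c) //= big1 ?addr0 => [|d dc].
      by rewrite !mxE enum_rankK_in // eqxx mulr1.
    by rewrite !mxE enum_rankK_in // (negPf dc) mulr0.
  rewrite mxE big1 // => i _; have [iS|iS] := boolP (i \in S0).
    by rewrite zero ?mulr0.
  by rewrite wS ?mul0r.
move/eqP: wAB0; rewrite mul_mx_row row_mx_eq0 => /andP[/eqP wA /eqP wB].
apply: inj => [i iT|].
  apply: wS; apply: contra iT; rewrite inE => /(subsetP ST)/imsetP[j jT []->]; exact: jT.
apply/mul_controllability_mx_eq0 => -[|k].
  have -> : A ^+ 0 *m B = B by apply: mul1mx.
  exact: wB.
have -> : A ^+ k.+1 *m B = A *m (A ^+ k *m B) by rewrite mulmxA exprS.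
by rewrite mulmxA wA mul0mx.
Qed.

(** * Sufficiency of the two conditions *)

Lemma target_controllable_sufficient (R : realType) n m (Abar : structured_matrix n n)
    (Bbar : structured_matrix n m) (T : {set 'I_n}) :
  symmetrically_structured Abar ->
  (forall i, i \in T -> input_reachable (system_digraph Abar Bbar) (inl i)) ->
  (forall S : {set vertex n m}, S \subset state_vertices m T ->
     (#|S| <= #|in_neighbours (system_digraph Abar Bbar) S|)%N) ->
  structurally_target_controllable R Abar Bbar T.
Proof.
move=> symAbar reachT hallT; set dg := system_digraph Abar Bbar in reachT hallT.
(* Orientation is dropped; since [Abar] is symmetric, the neighbours of a state vertex are exactly
   its in-neighbours ([e_in]). *)
pose e : rel 'I_(n + m) := fun x y => dg (split x) (split y) || dg (split y) (split x).
have syme : symmetric e by move=> x y; rewrite /e orbC.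
have split_l i : split (lshift m i) = inl i by apply: (unsplitK (inl i)).
have split_r j : split (rshift n j) = inr j by apply: (unsplitK (inr j)).
have e_in i y : e (lshift m i) y = dg (split y) (inl i).
  rewrite /e split_l orbC; case: (split y) => [j|j] /=; last by rewrite orbF.
  by rewrite symAbar orbb.
pose T' : {set 'I_(n + m)} := [set lshift m i | i in T].
pose V : {set 'I_(n + m)} := [set x | [exists j, connect dg (inr j) (split x)]].
pose U : {set 'I_(n + m)} := [set rshift n j | j : 'I_m].
have [f injf fF] : exists2 f : 'I_(n + m) -> 'I_(n + m), injective f &
    forall x, x \in T' -> e x (f x).
  (* Allowing everything outside [T'] makes the injection total. *)
  pose F x : {set 'I_(n + m)} := if x \in T' then [set y | e x y] else setT.
  have [|f injf fF] := @hall_marriage _ _ F; last first.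
    by exists f => // x xT; have := fF x; rewrite /F xT inE.
  move=> S; have [ST|/subsetPn[x xS xT]] := boolP (S \subset T'); last first.
    apply/subset_leq_card/subsetP => y _; apply/bigcupP; exists x => //.
    by rewrite /F (negPf xT) inE.
  have -> : #|S| = #|[set split x | x in S]|.
    by rewrite card_imset //; apply: can_inj splitK.
  apply: leq_trans (hallT _ _) _.
    apply/subsetP => _ /imsetP[x xS ->]; have /imsetP[i iT ->] := subsetP ST x xS.
    by rewrite split_l; apply: imset_f.
  rewrite -(card_imset _ (can_inj unsplitK)); apply/subset_leq_card/subsetP.
  move=> _ /imsetP[v + ->]; rewrite inE => /existsP[_ /andP[/imsetP[x xS ->] vx]].
  apply/bigcupP; exists x => //; have xT := subsetP ST x xS.
  by rewrite /F xT inE /e unsplitK vx orbT.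
(* Following a path from an input backwards from [x] never leaves [C], so [C] would contain that
   input. *)
have reachV (C : {set 'I_(n + m)}) : C \subset V -> [disjoint C & U] ->
    (forall x y, x \in C -> y \in V -> e x y -> y \in C) -> C = set0.
  move=> CV CU closedC; apply/setP => x; rewrite inE; apply/negP => xC.
  have := subsetP CV x xC; rewrite inE => /existsP[j /connectP[p pathp lastp]].
  elim/last_ind: p x xC pathp lastp => [|p v IHp] x xC /=.
    move=> _ xj; move/pred0P: CU => /(_ x) /=; rewrite xC /=.
    by rewrite -[x]splitK xj /= imset_f.
  rewrite rcons_path last_rcons => /andP[pathp edge] xv.
  apply: (IHp (unsplit (last (inr j) p))) => //; last by rewrite unsplitK.
  apply: (closedC x) => //; last by rewrite /e unsplitK xv edge orbT.
  by rewrite inE; apply/existsP; exists j; rewrite unsplitK; apply/connectP; exists p.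
have T'V x : x \in T' -> x \in V.
  by case/imsetP => i iT ->; rewrite inE split_l; apply/existsP/reachT.
have fV x : x \in T' -> f x \in V.
  move=> xT; have := fF x xT; have /imsetP[i iT xE] := xT; rewrite {1}xE e_in.
  rewrite inE; case: (split (f x)) => [j|j] edge; last by apply/existsP; exists j.
  have [u ui] := reachT i iT; apply/existsP; exists u.
  by apply: connect_trans ui (connect1 _); rewrite /= symAbar.
have [A0 [symA0 suppA0 injA0]] := injection_symmetric_mx R T' injf.
have adjA0 : weighted_adjacency e V A0.
  split=> // x y; apply: contraNeq => /suppA0[] [zT <-].
    by rewrite T'V // fV //= fF.
  by rewrite (T'V y) // fV //= syme fF.
have [N0 N0E] : exists N0, target_mx R T' *m A0 *m N0 = 1%:M.
  by apply/row_freeP/row_free_target_mxP.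
(* N0 is a right inverse at A0, so Q does not vanish at A0, and Q M != 0 keeps
   the rows T' of M independent. *)
pose Q M := \det (target_mx R T' *m M *m N0).
have polyQ : line_polynomial Q.
  apply: line_polynomial_det => M M'.
  exists (target_mx R T' *m M *m N0), (target_mx R T' *m M' *m N0) => t.
  by rewrite mulmxDr mulmxDl -scalemxAr -scalemxAl.
have QA0 : Q A0 != 0 by rewrite /Q N0E det1 oner_eq0.
have [M [[symM suppM] QM detM]] := generic_modes_detected syme reachV polyQ adjA0 QA0.
have injM : forall w : 'rV_(n + m),
    (forall x, x \notin T' -> w 0 x = 0) -> w *m M = 0 -> w = 0.
  apply/row_free_target_mxP; apply/row_freeP.
  exists (N0 *m invmx (target_mx R T' *m M *m N0)).
  by rewrite mulmxA mulmxV // unitmxE unitfE.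
pose A := ulsubmx M; pose B := ursubmx M.
have realA : realization Abar A.
  by move=> i j Aij; rewrite !mxE suppM // e_in split_l /= Aij !andbF.
have realB : realization Bbar B.
  by move=> i j Bij; rewrite !mxE suppM // e_in split_r /= Bij !andbF.
have symA : A^T = A by rewrite /A trmx_ulsub symM.
have extM (w : 'rV_n) l : w *m A = l *: w -> w *m B = 0 ->
    row_mx w (0 : 'rV_m) *m M = l *: row_mx w 0.
  move=> wA wB; rewrite -[M]submxK mul_row_block !mul0mx !addr0 -/A -/B wA wB.
  by rewrite scale_row_mx scaler0.
exists A, B; split=> //; first by split=> // i j; rewrite -[in LHS]symA mxE.
apply/row_free_target_mxP => w wT wC.
pose W := kermx (controllability_mx A B).
have kerB p (v : 'M[R]_(p, n)) : (v <= W)%MS -> v *m B = 0.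
  by move=> /sub_kermxP/mul_controllability_mx_eq0/(_ 0%N); rewrite mulmxA mulmx1.
have WA : W *m A = 0.
  apply/eqP/negPn/negP => WA0.
  have [l [v [l0 v0 vW vA]]] :=
    symmetric_stable_eigenvector symA (controllability_mx_stable A B) WA0.
  have vM := extM v l vA (kerB _ _ vW).
  have row0 : row_mx v (0 : 'rV_m) != 0 by rewrite row_mx_eq0 negb_and v0.
  have [|k /imsetP[j _ ->] detk] := detM l l0.
    by apply/eigenvalueP; exists (row_mx v 0).
  by case/eqP: row0; apply: detk => //; rewrite row_mxEr mxE.
have wW : (w <= W)%MS by apply/sub_kermxP.
have wA : w *m A = 0 *: w.
  by rewrite scale0r; have /submxP[y ->] := wW; rewrite -mulmxA WA mulmx0.
have /eqP : row_mx w (0 : 'rV_m) = 0.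
  apply: injM => [x xT|]; last by rewrite (extM w 0 wA (kerB _ _ wW)) scale0r.
  rewrite mxE; case: splitP => i xi; last by rewrite mxE.
  apply: wT; apply: contra xT => iT; apply/imsetP; exists i => //.
  exact: val_inj.
by rewrite row_mx_eq0 => /andP[/eqP].
Qed.

Theorem theorem2 (R : realType) (n m : nat)
    (Abar : structured_matrix n n) (Bbar : structured_matrix n m)
    (T : {set 'I_n}) (hA : symmetrically_structured Abar) :
  structurally_target_controllable R Abar Bbar T <->
  (forall x : vertex n m, x \in state_vertices m T ->
     input_reachable (system_digraph Abar Bbar) x) /\
  (forall S : {set vertex n m}, S \subset state_vertices m T ->
     (#|S| <= #|in_neighbours (system_digraph Abar Bbar) S|)%N).
Proof.
split=> [ctrl|[reachT hallT]].
  split=> [_ /imsetP[i iT ->]|S ST].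
    exact: target_controllable_reachable ctrl iT.
  exact: target_controllable_expansion ctrl ST.
apply: target_controllable_sufficient => // i iT.
by apply: reachT; apply: imset_f.
Qed.
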